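(* Let $\mathcal{N}$ be a parallel network with edge set $E$ and capacity $\gamma=\sum_{e\in E}\gamma_e$, let $K\in\mathbb{N}_{+}$ and $\boldsymbol{\delta}\in\mathbb{N}_K(\gamma)$, and consider the game $\Gamma(\mathcal{N},K,\boldsymbol{\delta})$ with $K$-periodic inflow $\boldsymbol{\delta}$. Then $$\mathsf{Opt}(\mathcal{N},K,\boldsymbol{\delta})=K\sum_{e\in E}\gamma_e\tau_e+D(\boldsymbol{\delta}),$$ $$\mathsf{WEq}(\mathcal{N},K,\boldsymbol{\delta})=K\gamma\max_{e\in E}\tau_e+D(\boldsymbol{\delta}).$$
   Context: **Parallel network.** $\mathbb{N}=\{0,1,2,\dots\}$, $\mathbb{N}_{+}=\{1,2,\dots\}$. A parallel network $\mathcal{N}$ has two vertices, source $s$ and destination $d$, and a finite set $E$ of edges, all from $s$ to $d$; each $e\in E$ has a free-flow transit cost $\tau_e\in\mathbb{N}$ and a positive integer capacity $\gamma_e$. A route is a single edge, so the set of routes is $\mathcal{R}=E$. **Periodic inflow.** $\mathbb{N}_K(\gamma)$ is the set of $K$-dimensional vectors $\boldsymbol{\delta}=(\delta_1,\dots,\delta_K)$ of nonnegative integers with $\sum_{k=1}^K\delta_k=\gamma K$. Such a vector is identified with the $K$-periodic inflow sequence $(\delta_t)_{t\in\mathbb{N}_+}$, $\delta_{t+K}=\delta_t$. **Game $\Gamma(\mathcal{N},K,\boldsymbol{\delta})$.** Time is discrete. At each stage $t\in\mathbb{N}_{+}$ a generation $G_t$ of $\delta_t$ players departs from $s$; $[it]$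 denotes the $i$-th player of $G_t$, and $G=\bigcup_t G_t$. Priority: $[js]\lhd[it]$ iff $s<t$, or $s=t$ and $j<i$. Each player chooses a route; a strategy profile is $\sigma\in\mathcal{R}^{G}$. Player $[it]$ enters her edge $e$ at time $t$ and reaches its head at time $t+\tau_e$, where there may be a queue. Players in the queue of $e$ are ordered by time of entry into $e$, ties being broken by the priority $\lhd$ (no overtaking). At each stage at most $\gamma_e$ players, the first ones in the queue, exit $e$: a player who has reached the head exits at that stage if fewer than $\gamma_e$ players are in the queue ahead of her, and otherwise waits one stage and the process repeats. **Latencies.** The latency of $[it]$ is $\ell_{it}(\sigma)=c_{it}(\sigma)+w_{it}(\sigma)$, where $c_{it}(\sigma)$ is the transit cost of her route and $w_{it}(\sigma)$ is the number of stages she spends waiting in the queue. Put $\ell_t(\sigma)=\sum_{[it]\in G_t}\ell_{it}(\sigma)$, $L_p(\sigma)=\sum_{t=pK+1}^{(p+1)K}\ell_t(\sigma)$ and $\widetilde L_P(\sigma)=\frac1P\sum_{p=1}^{P}L_p(\sigma)$. **Optimum.** $\sigma$ is socially optimal if $\liminf_{P\to\infty}\widetilde L_P(\sigma')\ge\limsup_{P\to\infty}\widetilde L_P(\sigma)$ for all $\sigma'\in\mathcal{R}^G$; $\mathsf{Opt}(\mathcal{N},K,\boldsymbol{\delta})=\lim_{P\to\infty}\widetilde L_P(\sigma)$ for any socially optimal $\sigma$. **Equilibrium.** $\sigma$ is a Nash equilibrium if $\ell_{it}(\sigma)\le\ell_{it}(\sigma'_{it},\sigma_{-it})$ for every player $[it]\in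 G$ and every $\sigma'_{it}\in\mathcal{R}$. A Nash equilibrium is a uniformly fastest route (UFR) equilibrium if for every player $[it]$ and every vertex $v$ on her route there is no alternative route allowing $[it]$ to arrive at $v$ earlier (given $\sigma_{-it}$). $\mathsf{WEq}(\mathcal{N},K,\boldsymbol{\delta})=\sup_{\sigma}\limsup_{P\to\infty}\widetilde L_P(\sigma)$, the supremum being over UFR equilibria $\sigma$. **The quantity $D(\boldsymbol{\delta})$.** For $\boldsymbol{\delta},\boldsymbol{\delta}'\in\mathbb{N}_K(\gamma)$ write $\boldsymbol{\delta}\to\boldsymbol{\delta}'$ ($\boldsymbol{\delta}'$ is obtained from $\boldsymbol{\delta}$ by an elementary operation) if there is a $t\in\{1,\dots,K\}$ with $\delta_t>\gamma$, $\delta'_t=\delta_t-1$, $\delta'_{t+1}=\delta_{t+1}+1$ and $\delta'_k=\delta_k$ for $k\notin\{t,t+1\}$, indices being taken modulo $K$. $D(\boldsymbol{\delta})$ is the distance from $\boldsymbol{\delta}$ to the uniform vector $(\gamma,\dots,\gamma)\in\mathbb{N}_K(\gamma)$ in the directed graph of the relation $\to$, i.e. the minimum number of elementary operations needed to transform $\boldsymbol{\delta}$ into $(\gamma,\dots,\gamma)$. *)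

(* Defs.v *)
From mathcomp Require Import all_boot all_order all_algebra.
From mathcomp Require Import all_classical all_reals all_analysis.

Set Implicit Arguments.
Unset Strict Implicit.
Unset Printing Implicit Defensive.

Import Order.TTheory GRing.Theory Num.Theory.

Local Open Scope nat_scope.

Record parallel_network := ParallelNetwork {
  edge : finType;
  transit : edge -> nat;
  cap : edge -> nat;
  cap_gt0 : forall e, 0 < cap e }.

Definition capacity (N : parallel_network) : nat := \sum_(e : edge N) cap e.

(* A vector (delta_1, ..., delta_K) is a K-tuple; delta_k is the entry of index
   k - 1. *)
Definition inflow_vector (K gam : nat) : pred (K.-tuple nat) :=
  [pred delta : K.-tuple nat | \sum_(k < K) tnth delta k == gam * K].
Arguments inflow_vector : clear implicits.

(* Stages are numbered from 1; stage 0 is a dummy one without departures. *)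
Definition inflow (K : nat) (delta : K.-tuple nat) (t : nat) : nat :=
  if t is t'.+1 then nth 0 delta (t' %% K) else 0.

(* existT _ t i is the (i + 1)-th player of generation t. *)
Definition player (K : nat) (delta : K.-tuple nat) : Type :=
  {t : nat & 'I_(inflow delta t)}.

Definition mk_player (K : nat) (delta : K.-tuple nat) (t : nat)
  (i : 'I_(inflow delta t)) : player delta := existT _ t i.

Definition departure (K : nat) (delta : K.-tuple nat) (x : player delta) : nat :=
  tag x.

Section Game.
Variables (N : parallel_network) (K : nat) (delta : K.-tuple nat).

Definition profile : Type := player delta -> edge N.

Implicit Types (sigma : profile) (e : edge N) (x : player delta).

(* The players of generation t, in decreasing order of priority: [enum 'I_n]
   is increasing. *)
Definition generation (t : nat) : seq (player delta) :=
  [seq mk_player i | i <- enum 'I_(inflow delta t)].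

(* The players reaching the head of e at stage t, in queueing order.  When
   t < transit e the truncated subtraction designates the empty generation 0. *)
Definition arrivals sigma e (t : nat) : seq (player delta) :=
  [seq x <- generation (t - transit e) | sigma x == e].

(* The players still in the queue of e at the end of stage t. *)
Fixpoint waiting sigma e (t : nat) : seq (player delta) :=
  drop (cap e)
    ((if t is t'.+1 then waiting sigma e t' else [::]) ++ arrivals sigma e t).

(* The queue of e at stage t, before the exits of that stage. *)
Definition queue sigma e (t : nat) : seq (player delta) :=
  (if t is t'.+1 then waiting sigma e t' else [::]) ++ arrivals sigma e t.

Definition exits sigma e (t : nat) : seq (player delta) :=
  take (cap e) (queue sigma e t).

Definition reach_head sigma x : nat := departure x + transit (sigma x).

Lemma waitingE sigma e t : waiting sigma e t = drop (cap e) (queue sigma e t).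
Proof. by case: t. Qed.

Lemma mem_queue_reach_head sigma x :
  x \in queue sigma (sigma x) (reach_head sigma x).
Proof.
rewrite /queue mem_cat; apply/orP; right.
rewrite mem_filter eqxx /reach_head addnK /=.
by case: x => t i; apply: map_f; rewrite mem_enum.
Qed.

Lemma queue_exits sigma e x t :
  x \in queue sigma e t -> exists n, x \in exits sigma e (t + n).
Proof.
have [m] := ubnP (index x (queue sigma e t)).
elim: m t => // m IHm t; rewrite ltnS => le_m x_q.
case: (boolP (x \in exits sigma e t)) => [|/negbTE x_ex].
  by exists 0; rewrite addn0.
have x_w : x \in drop (cap e) (queue sigma e t).
  by move: x_q; rewrite -{1}(cat_take_drop (cap e) (queue sigma e t)) mem_cat
    -/(exits sigma e t) x_ex.
have x_q1 : x \in queue sigma e t.+1 by rewrite /queue mem_cat waitingE x_w.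
suff [n n_ex] : exists n, x \in exits sigma e (t.+1 + n).
  by exists n.+1; rewrite addnS -addSn.
apply: IHm (x_q1).
rewrite /queue index_cat waitingE x_w; apply: leq_trans le_m.
rewrite -{2}(cat_take_drop (cap e) (queue sigma e t)) index_cat
  -/(exits sigma e t) x_ex /exits.
rewrite size_takel; last first.
  by rewrite leqNgt; apply/negP => /ltnW sz; rewrite drop_oversize in x_w.
by rewrite -[X in X < _]add0n ltn_add2r cap_gt0.
Qed.

Lemma eventually_exits sigma x :
  exists n, x \in exits sigma (sigma x) (reach_head sigma x + n).
Proof. exact/queue_exits/mem_queue_reach_head. Qed.

Definition waiting_cost sigma x : nat := ex_minn (eventually_exits sigma x).

Definition latency sigma x : nat := transit (sigma x) + waiting_cost sigma x.

Definition stage_latency sigma (t : nat) : nat :=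
  \sum_(i < inflow delta t) latency sigma (mk_player i).

Definition period_latency sigma (p : nat) : nat :=
  \sum_((p * K).+1 <= t < (p.+1 * K).+1) stage_latency sigma t.

Definition avg_latency (R : realType) sigma (P : nat) : \bar R :=
  ((P%:R)^-1 * (\sum_(1 <= p < P.+1) period_latency sigma p)%:R)%R%:E.

Definition socially_optimal (R : realType) sigma : Prop :=
  forall sigma' : profile,
    (limn_esup (avg_latency R sigma) <= limn_einf (avg_latency R sigma'))%E.

(* [v] is the optimum cost: socially optimal profiles exist, and the averages
   of each of them converge to [v]. *)
Definition is_opt (R : realType) (v : \bar R) : Prop :=
  (exists sigma, socially_optimal R sigma) /\
  (forall sigma, socially_optimal R sigma ->
     (avg_latency R sigma @ \oo --> v)%classic).

Definition deviate sigma x e : profile := [eta sigma with x |-> e].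

Definition nash_equilibrium sigma : Prop :=
  forall x e, latency sigma x <= latency (deviate sigma x e) x.

Inductive vertex := source | destination.

(* Every route visits both vertices. *)
Definition arrival_time sigma x (v : vertex) : nat :=
  match v with
  | source => departure x
  | destination => departure x + latency sigma x
  end.

Definition ufr_equilibrium sigma : Prop :=
  nash_equilibrium sigma /\
  forall x v e, arrival_time sigma x v <= arrival_time (deviate sigma x e) x v.

Definition weq (R : realType) : \bar R :=
  ereal_sup [set limn_esup (avg_latency R sigma) | sigma in ufr_equilibrium]%classic.

End Game.

Definition uniform_vector (K gam : nat) : K.-tuple nat := [tuple gam | k < K].

Definition elementary_op (K gam : nat) : rel (K.-tuple nat) :=
  fun delta delta' =>
    [&& delta \in inflow_vector K gam, delta' \in inflow_vector K gam &
      [exists t : 'I_K,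
        [&& gam < tnth delta t,
            tnth delta' t == tnth delta t - 1,
            tnth delta' (ordS t) == tnth delta (ordS t) + 1 &
            [forall k : 'I_K, (k \notin [:: t; ordS t]) ==>
                              (tnth delta' k == tnth delta k)]]]].

(* The distance to the uniform vector; it would be +oo if that vector could not
   be reached. *)
Definition uniform_distance (R : realType) (K gam : nat) (delta : K.-tuple nat) :
    \bar R :=
  ereal_inf [set ((size p)%:R)%R%:E | p in
    [set p : seq (K.-tuple nat) |
      path (elementary_op gam) delta p /\
      last delta p = uniform_vector K gam]]%classic.

(* Main.v *)
Require Import Defs.
From mathcomp Require Import all_boot all_order all_algebra.
From mathcomp Require Import all_classical all_reals all_analysis.
From mathcomp Require Import zify lra.

Set Implicit Arguments.
Unset Strict Implicit.
Unset Printing Implicit Defensive.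

Local Open Scope nat_scope.

(** Compare the network with a single server of capacity [gam], the capacity of
    the network, fed by the inflow.  Its backlog is periodic after the first
    period, and its sum over a period is [D(delta)], since every elementary
    operation removes one unit of waiting.

    Optimum: whatever the routes, from an instant at which the single server is
    idle on, the number of players in the network exceeds the backlog of that
    server by at least [\sum_e cap e * transit e], because [e] releases at most
    [cap e] players per stage, after a delay [transit e].  Dispatching the
    positions in the virtual queue cyclically among the edges is optimal.

    Equilibrium: a player chooses the earliest free exit slot, so the slots are
    filled in chronological order across the edges.  If a slot of some edge is
    lost, all the present players exit within the maximal transit cost [M];
    hence latencies never exceed [M] plus the virtual waiting time.  If ties are
    broken in favour of short edges, a stage at which no slot is lost leaves on
    every edge a queue of latency at least [M]; and a period with a lost slot
    raises the total queue length at the next idle instant of the single server,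
    which can happen only finitely often. *)

(** * The backlog of a single server *)

Fixpoint backlog (f : nat -> nat) (g t : nat) : nat :=
  if t is t'.+1 then backlog f g t' + f t' - g else 0.

Lemma backlogS f g t : backlog f g t.+1 = backlog f g t + f t - g.
Proof. by []. Qed.

Section Backlog.
Variables (f : nat -> nat) (g : nat).
Local Notation W := (backlog f g).

(** Truncating the subtraction can only raise the backlog; [backlog_conserved] is the equality case,
    where the capacity is used up at every stage. *)
Lemma backlog_lower s t : s <= t ->
  W s + \sum_(s <= r < t) f r <= W t + g * (t - s).
Proof.
elim: t => [|t IHt].
  by rewrite leqn0 => /eqP->; rewrite big_geq // addn0 leq_addr.
rewrite leq_eqVlt => /predU1P[->|]; first by rewrite big_geq // subnn muln0.
rewrite ltnS => st; move: (IHt st); rewrite big_nat_recr //= subSn // mulnS.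
lia.
Qed.

Lemma backlog_conserved s t : s <= t ->
    (forall r, s <= r < t -> g <= W r + f r) ->
  W t + g * (t - s) = W s + \sum_(s <= r < t) f r.
Proof.
elim: t => [|t IHt].
  by rewrite leqn0 => /eqP->; rewrite big_geq // subnn muln0.
rewrite leq_eqVlt => /predU1P[->|].
  by rewrite big_geq // subnn muln0.
rewrite ltnS => st le_g; have le_gt := le_g t; rewrite st leqnn in le_gt.
have {}IHt : W t + g * (t - s) = W s + \sum_(s <= r < t) f r.
  by apply: IHt => // r /andP[sr rt]; apply: le_g; rewrite sr ltnW.
rewrite big_nat_recr //= subSn // mulnS; have := le_gt isT; lia.
Qed.

End Backlog.

Lemma eq_backlog (f f' : nat -> nat) (g t : nat) :
  (forall r, r < t -> f r = f' r) -> backlog f g t = backlog f' g t.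
Proof.
elim: t => //= t IHt eq_f; rewrite eq_f // IHt // => r rt.
exact/eq_f/ltnW.
Qed.

(** * Periodic inflow whose mean is the capacity *)

Section PeriodicBacklog.
Variables (f : nat -> nat) (g K : nat).
Local Notation W := (backlog f g).
Hypothesis f_periodic : forall t, f (t + K) = f t.
Hypothesis f_mean : \sum_(0 <= r < K) f r = g * K.

Lemma sum_period a : \sum_(a <= r < a + K) f r = g * K.
Proof.
elim: a => [|a <-] //; have [->|K_gt0] := posnP K.
  by rewrite !big_geq ?addn0.
rewrite addSn big_nat_recr ?f_periodic; last by lia.
by rewrite [RHS]big_ltn /=; lia.
Qed.

(* Capacity wasted at stage t would, over the period ending there, have
   to show up as a positive backlog at t + 1; but waste empties the queue. *)
Lemma backlog_no_waste t : K <= t.+1 -> 0 < K -> g <= W t + f t.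
Proof.
move=> Kt K_gt0; rewrite leqNgt; apply/negP => waste.
have W0 : W t.+1 = 0 by rewrite /=; lia.
have st : t.+1 - K <= t by lia.
have := backlog_lower f g st; have := sum_period (t.+1 - K).
rewrite subnK // big_nat_recr //=.
have -> : t - (t.+1 - K) = K.-1 by lia.
have -> : g * K = g * K.-1 + g by rewrite -{1}(prednK K_gt0) mulnS addnC.
lia.
Qed.

Lemma backlog_periodic t : K <= t -> 0 < K -> W (t + K) = W t.
Proof.
move=> Kt K_gt0; apply: (@addIn (g * K)); rewrite -[in RHS](sum_period t).
rewrite -{2}(addKn t K) backlog_conserved ?leq_addr // => r /andP[tr _].
by apply: backlog_no_waste => //; lia.
Qed.

(** Start from the last empty time [s] of the first period. Waste between [s] and the end of that
    period would create a later one, and there is none afterwards, so the backlog is conserved from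
    [s] to [s + K]. *)
Lemma backlog_zero : 0 < K -> exists2 z, K <= z < K + K & W z = 0.
Proof.
move=> K_gt0; pose P s := (s < K) && (W s == 0).
have exP : exists s, P s by exists 0; rewrite /P K_gt0.
have P_le s : P s -> s <= K by case/andP => /ltnW.
have [s /andP[sK /eqP Ws] s_max] := ex_maxnP exP P_le.
exists (s + K); first lia.
rewrite -[RHS]Ws.
apply: (@addIn (g * K)); rewrite -[in RHS](sum_period s).
rewrite -{2}(addKn s K) backlog_conserved ?leq_addr // => r /andP[sr _].
have [Kr|rK] := leqP K r.+1; first exact: backlog_no_waste.
rewrite leqNgt; apply/negP => waste.
have /s_max : P r.+1 by rewrite /P rK /=; lia.
lia.
Qed.

Lemma backlog_periodicM t j : K <= t -> 0 < K -> W (t + j * K) = W t.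
Proof.
move=> Kt K_gt0; elim: j => [|j IHj]; first by rewrite addn0.
by rewrite mulSn addnCA addnC backlog_periodic //; lia.
Qed.

Lemma sum_backlog_period a b : K <= a -> K <= b -> 0 < K ->
  \sum_(a <= t < a + K) W t = \sum_(b <= t < b + K) W t.
Proof.
move=> Ka Kb K_gt0.
suff base c : K <= c ->
  \sum_(c <= t < c + K) W t = \sum_(K <= t < K + K) W t by rewrite !base.
elim: c => [|c IHc]; first by rewrite leqn0 => /eqP->.
rewrite leq_eqVlt => /predU1P[<-//|]; rewrite ltnS => Kc; rewrite -IHc //.
rewrite addSn big_nat_recr ?backlog_periodic //; last by lia.
by rewrite [RHS]big_ltn /=; lia.
Qed.

End PeriodicBacklog.

(** * Total waiting times and delayed sums *)

(** The total waiting time of [m] queued players served at rate [g]: the one with [j] players ahead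
    waits [j %/ g] stages. *)
Definition div_sum (g m : nat) : nat := \sum_(j < m) j %/ g.

Lemma div_sumS g m : div_sum g m.+1 = div_sum g m + m %/ g.
Proof. exact: big_ord_recr. Qed.

(** One stage of service: the first [g] players leave at once, and each of the others waits one
    stage more than from her next position. *)
Lemma div_sumB g m : 0 < g -> div_sum g m = div_sum g (m - g) + (m - g).
Proof.
move=> g_gt0; elim: m => [|m IHm]; first by rewrite sub0n addn0.
rewrite div_sumS; have [mg|gm] := ltnP m g.
  have m0 : m - g = 0 by lia.
  have -> : m.+1 - g = 0 by lia.
  by rewrite divn_small // IHm m0 !addn0.
have -> : m %/ g = (m - g) %/ g + 1.
  by rewrite -{1}(subnK gm) divnDr // divnn g_gt0.
by rewrite subSn // div_sumS IHm; lia.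
Qed.

Lemma div_sumD g a b :
  div_sum g (a + b) = div_sum g a + \sum_(i < b) (a + i) %/ g.
Proof. exact: big_split_ord. Qed.

Lemma sum_lag (A : nat -> nat) (d T : nat) : A 0 = 0 ->
  \sum_(0 <= t < T) A (t - d) <= A (T.-1 - d) + \sum_(0 <= t < T) A (t - d.+1).
Proof.
move=> A0; elim: T => [|T IHT]; first by rewrite !big_geq.
rewrite !big_nat_recr //=; case: T IHT => [|T].
  by rewrite !big_geq // !sub0n; lia.
by rewrite /= subSS; lia.
Qed.

(** For [A] a cumulative load and [d] a transit cost, this bounds the stages spent travelling by [d]
    per player. *)
Lemma sum_lag_mono (A : nat -> nat) (d T : nat) : A 0 = 0 ->
    {homo A : s t / s <= t} ->
  \sum_(0 <= t < T) A t <= d * A T + \sum_(0 <= t < T) A (t - d).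
Proof.
move=> A0 Amono; elim: d => [|d IHd].
  by rewrite mul0n add0n; under [X in _ <= X]eq_bigr do rewrite subn0.
have := sum_lag d T A0; have : A (T.-1 - d) <= A T by apply: Amono; lia.
lia.
Qed.

Lemma sum_lag_le (A : nat -> nat) (d T : nat) : A 0 = 0 ->
  \sum_(0 <= t < T) A (t - d) <= \sum_(0 <= t < T) A t.
Proof.
move=> A0; elim: T => [|T IHT]; first by rewrite !big_geq.
have [dT|Td] := leqP d T; last first.
  rewrite big1_seq // => t /=; rewrite mem_index_iota => tT.
  by have -> : t - d = 0 by lia.
have -> : \sum_(0 <= t < T.+1) A (t - d) = \sum_(0 <= t < T.+1 - d) A t.
  rewrite (@big_cat_nat _ _ _ d) //=; last by lia.
  rewrite big1_seq => [|t /=]; last first.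
    by rewrite mem_index_iota => td; have -> : t - d = 0 by lia.
  rewrite add0n -{1}[d]add0n big_addn; apply: eq_bigr => t _.
  by rewrite addnK.
by rewrite [X in _ <= X](@big_cat_nat _ _ _ (T.+1 - d)) ?leq_addr ?leq_subr.
Qed.

Arguments backlog : simpl never.

(** * Elementary operations and the distance to the uniform vector *)

Section ElementaryOperations.
Variables (K gam : nat).
Implicit Types (delta : K.-tuple nat) (h : 'I_K -> nat).

(* [h k] is the backlog before stage [k] of the periodic regime of a single
   server of capacity [gam]; every elementary operation lowers [\sum_k h k] by
   one. *)
Definition excess delta h : Prop :=
  (forall k, h (ordS k) + gam = h k + tnth delta k) /\ exists k, h k = 0.

Lemma iter_ordS n (k : 'I_K) : iter n (@ordS K) k = (k + n) %% K :> nat.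
Proof.
elim: n => [|n IHn] /=; first by rewrite addn0 modn_small.
by rewrite IHn -addn1 modnDml addn1 addnS.
Qed.

Lemma ordS_orbit (k0 k : 'I_K) : exists n, iter n (@ordS K) k0 = k.
Proof.
exists (k + (K - k0)); apply: val_inj.
by rewrite /= iter_ordS addnCA subnKC ?(ltnW (ltn_ord _)) // modnDr modn_small.
Qed.

Lemma excess_uniform h : excess (uniform_vector K gam) h -> forall k, h k = 0.
Proof.
move=> [hS [k0 hk0]] k.
have {}hS i : h (ordS i) = h i by have := hS i; rewrite tnth_mktuple => /addIn.
have h_iter n : h (iter n (@ordS K) k0) = 0 by elim: n => //= n; rewrite hS.
by have [n <-] := ordS_orbit k0 k.
Qed.

(** Delaying one departure of stage [t] affects only the backlog before [ordS t]. That backlog is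
    positive because the inflow at [t] exceeds [gam], so it can drop by one, and the zero of [h]
    lies elsewhere. *)
Lemma elementary_op_excess delta delta' h : elementary_op gam delta delta' ->
    excess delta h ->
  exists2 h', excess delta' h' & \sum_k h k = (\sum_k h' k).+1.
Proof.
move=> /and3P[_ _ /existsP[t /and4P[gt_t /eqP dt /eqP dSt /forallP d_id]]].
move=> [hS [k0 hk0]].
have hSt : 0 < h (ordS t) by have := hS t; lia.
have neqSt : ordS t != t by apply/eqP => St; rewrite St in dSt; lia.
pose h' k := if k == ordS t then (h k).-1 else h k.
exists h'; last first.
  rewrite (bigD1 (ordS t)) //= [in RHS](bigD1 (ordS t)) //= {1}/h' eqxx.
  rewrite -{1}(prednK hSt) addSn; congr (_ + _).+1; apply: eq_bigr => k.
  by rewrite /h' => /negbTE ->.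
split; last first.
  by exists k0; rewrite /h'; case: eqP => // k0E; rewrite -k0E hk0 in hSt.
move=> k; have := hS k; rewrite /h' (inj_eq (@ordS_inj K)).
have [->|kt] := eqVneq k t; first by rewrite eq_sym (negbTE neqSt); lia.
have [->|kSt] := eqVneq k (ordS t); first by lia.
have := d_id k; rewrite !inE (negbTE kt) (negbTE kSt) /= => /eqP ->; lia.
Qed.

(** All paths to the uniform vector thus have the same length, so the infimum defining the distance
    is trivial. *)
Lemma size_path_uniform delta p h : excess delta h ->
    path (elementary_op gam) delta p -> last delta p = uniform_vector K gam ->
  size p = \sum_k h k.
Proof.
elim: p delta h => [|delta' p IHp] delta h exc /=.
  by move=> _ deltaE; rewrite deltaE in exc; rewrite big1 // => k _;
    apply: (excess_uniform exc).
move=> /andP[op pth] lst; have [h' exc' ->] := elementary_op_excess op exc.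
by rewrite (IHp _ h' exc').
Qed.

Lemma elementary_op_exists delta : delta \in inflow_vector K gam ->
    delta != uniform_vector K gam ->
  exists delta', elementary_op gam delta delta'.
Proof.
move=> deltaP; have [t gt_t _|le_gam] := pickP (fun t => gam < tnth delta t).
  (* If [ordS t = t], there is a single stage, whose inflow is the mean [gam] and cannot exceed
     it. *)
  have K_gt1 : ordS t != t.
    apply/eqP => St; have t0 (k : 'I_K) : k = t.
      have St_iter n : iter n (@ordS K) t = t by elim: n => //= n ->.
      by have [n <-] := ordS_orbit t k.
    move: deltaP; rewrite inE (bigD1 t) //= big1 => [|k]; last first.
      by rewrite (t0 k) eqxx.
    have -> : gam * K = gam.
      rewrite -[X in _ * X]card_ord -sum1_card (bigD1 t) //= big1 => [|k].
        by rewrite muln1.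
      by rewrite (t0 k) eqxx.
    by rewrite addn0 => /eqP deltat; rewrite deltat ltnn in gt_t.
  pose delta' : K.-tuple nat := [tuple if k == t then tnth delta k - 1
    else if k == ordS t then tnth delta k + 1 else tnth delta k | k < K].
  exists delta'; rewrite /elementary_op deltaP /=.
  apply/andP; split; last first.
    apply/existsP; exists t.
    rewrite gt_t !tnth_mktuple eqxx (negbTE K_gt1) !eqxx /=.
    apply/forallP => k; apply/implyP.
    by rewrite !inE negb_or tnth_mktuple => /andP[/negbTE-> /negbTE->].
  move: deltaP; rewrite !inE (bigD1 t) // (bigD1 (ordS t)) //=.
  rewrite [in X in _ -> X](bigD1 t) // [in X in _ -> X](bigD1 (ordS t)) //=.
  rewrite !tnth_mktuple eqxx (negbTE K_gt1) eqxx.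
  under [in X in _ -> X]eq_bigr => k /andP[/negbTE kt /negbTE kSt] do
    rewrite tnth_mktuple kt kSt.
  lia.
move=> /eqP[]; apply: eq_from_tnth => t; rewrite tnth_mktuple.
(* No entry exceeds the mean [gam], so the equality case of the summed inequality makes them all
   equal to it. *)
have le_d k : tnth delta k <= gam by rewrite leqNgt le_gam.
have := leqif_sum (fun k (_ : true) => leqif_eq (le_d k)).
move/eqP: deltaP => -> [_]; rewrite sum_nat_const card_ord mulnC eqxx.
by move=> /esym/forallP/(_ t)/eqP.
Qed.

Lemma uniform_path delta h : delta \in inflow_vector K gam -> excess delta h ->
  exists2 p, path (elementary_op gam) delta p &
    last delta p = uniform_vector K gam.
Proof.
have [n] := ubnP (\sum_k h k).
elim: n delta h => // n IHn delta h lt_n deltaP exc.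
have [->|neq] := eqVneq delta (uniform_vector K gam); first by exists [::].
have [delta' op] := elementary_op_exists deltaP neq.
have [h' exc' sumE] := elementary_op_excess op exc.
have [_ delta'P _] := and3P op.
rewrite sumE ltnS in lt_n; have [p pth lst] := IHn delta' h' lt_n delta'P exc'.
by exists (delta' :: p); rewrite //= op.
Qed.

Lemma uniform_distance_excess (R : realType) delta h :
    delta \in inflow_vector K gam -> excess delta h ->
  uniform_distance R gam delta = ((\sum_k h k)%:R)%R%:E.
Proof.
move=> deltaP exc; have [p pth lst] := uniform_path deltaP exc.
rewrite /uniform_distance -(size_path_uniform exc pth lst).
rewrite -[RHS]ereal_inf1; congr ereal_inf.
apply/seteqP; split => [_ [q [qp ql] <-]|_ ->].
  by rewrite /= (size_path_uniform exc qp ql) (size_path_uniform exc pth lst).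
by exists p.
Qed.

End ElementaryOperations.

(** * Queues as counters: ranks, waiting costs, latencies *)

Lemma sum_ord_ltS m i (hi : i < m) (F : 'I_m -> nat) :
  \sum_(j < m | j < i.+1) F j = \sum_(j < m | j < i) F j + F (Ordinal hi).
Proof.
rewrite (bigD1 (Ordinal hi)) ?ltnS //= addnC; congr (_ + _).
apply: eq_bigl => j; rewrite ltnS [in RHS]ltn_neqAle andbC.
by congr (_ && _); rewrite -val_eqE.
Qed.

Section Rank.
Variables (N : parallel_network) (K : nat) (delta : K.-tuple nat).
Implicit Types (sigma : profile N delta) (e : edge N) (x y : player delta).

Definition joined sigma t i e : nat :=
  \sum_(j < inflow delta t | j < i) (sigma (mk_player j) == e).

Definition load sigma e t : nat := joined sigma t (inflow delta t) e.

(* Indexed by departure stages: the queue of [e] at stage [t + transit e] just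
   before generation [t] joins it. *)
Definition left_over sigma e : nat -> nat := backlog (load sigma e) (cap e).

(* The number of players who are ahead of the player [i] of generation [t] in
   the queue of [e] if she chooses [e]. *)
Definition rank sigma t i e : nat := left_over sigma e t + joined sigma t i e.

Lemma joined0 sigma t e : joined sigma t 0 e = 0.
Proof. by rewrite /joined big_pred0. Qed.

Lemma joinedS sigma t (i : 'I_(inflow delta t)) e :
  joined sigma t i.+1 e = joined sigma t i e + (sigma (mk_player i) == e).
Proof.
rewrite /joined (sum_ord_ltS (ltn_ord i)).
by congr (_ + nat_of_bool (sigma (mk_player _) == e)); apply: val_inj.
Qed.

Lemma rank0 sigma t e : rank sigma t 0 e = left_over sigma e t.
Proof. by rewrite /rank joined0 addn0. Qed.

Lemma rankS sigma t (i : 'I_(inflow delta t)) e :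
  rank sigma t i.+1 e = rank sigma t i e + (sigma (mk_player i) == e).
Proof. by rewrite /rank joinedS addnA. Qed.

Lemma left_overS sigma t e :
  left_over sigma e t.+1 = rank sigma t (inflow delta t) e - cap e.
Proof. by []. Qed.

Lemma sum_joined sigma t i : i <= inflow delta t ->
  \sum_e joined sigma t i e = i.
Proof.
elim: i => [|i IHi] hi; first by rewrite big1 // => e _; rewrite joined0.
under eq_bigr => e _ do rewrite (joinedS sigma (Ordinal hi)).
rewrite big_split /= IHi ?(ltnW hi) //.
rewrite (bigD1 (sigma (mk_player (Ordinal hi)))) //=.
rewrite eqxx big1 => [|e /negbTE]; first by rewrite addn0 addn1.
by rewrite eq_sym => ->.
Qed.

Lemma sum_load sigma t : \sum_e load sigma e t = inflow delta t.
Proof. exact: sum_joined. Qed.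

Lemma sum_rank sigma t i : i <= inflow delta t ->
  \sum_e rank sigma t i e = \sum_e left_over sigma e t + i.
Proof. by move=> hi; rewrite big_split /= sum_joined. Qed.

Lemma eq_joined sigma sigma' t i :
    (forall j : 'I_(inflow delta t), j < i ->
      sigma (mk_player j) = sigma' (mk_player j)) ->
  joined sigma t i =1 joined sigma' t i.
Proof. by move=> eqs e; apply: eq_bigr => j /eqs->. Qed.

(** By the no-overtaking rule only choices of higher priority count; hence a deviation leaves the
    ranks faced by the deviating player unchanged. *)
Lemma eq_rank sigma sigma' t i :
    (forall s (j : 'I_(inflow delta s)), s < t \/ s = t /\ j < i ->
      sigma (mk_player j) = sigma' (mk_player j)) ->
  rank sigma t i =1 rank sigma' t i.
Proof.
move=> eqs e; rewrite /rank (eq_joined (sigma' := sigma')) => [|j ji];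
  last by apply: eqs; right.
congr (_ + _); apply: eq_backlog => s st; apply: eq_joined => j _.
by apply: eqs; left.
Qed.

Lemma size_generation t : size (generation delta t) = inflow delta t.
Proof. by rewrite size_map size_enum_ord. Qed.

Lemma generation0 : generation delta 0 = [::].
Proof. by apply: size0nil; rewrite size_generation. Qed.

Lemma nth_generation t (i : 'I_(inflow delta t)) x0 :
  nth x0 (generation delta t) i = mk_player i.
Proof. by rewrite (nth_map i) ?size_enum_ord // nth_ord_enum. Qed.

Lemma mk_player_inj t : injective (@mk_player K delta t).
Proof.
by move=> i j /eqP; rewrite -tag_eqE /tag_eq /= eqxx /= tagged_asE => /eqP.
Qed.

Lemma generation_uniq t : uniq (generation delta t).
Proof. by rewrite map_inj_uniq ?enum_uniq //; apply: mk_player_inj. Qed.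

Lemma departure_generation t y : y \in generation delta t -> departure y = t.
Proof. by move=> /mapP[i _ ->]. Qed.

Lemma count_generation sigma t i e : i <= inflow delta t ->
  count (fun x => sigma x == e) (take i (generation delta t)) =
    joined sigma t i e.
Proof.
elim: i => [|i IHi] hi; first by rewrite take0 joined0.
rewrite (take_nth (mk_player (Ordinal hi))) ?size_generation //.
rewrite -cats1 count_cat IHi ?(ltnW hi) // (joinedS sigma (Ordinal hi)) /=.
by rewrite addn0 (nth_generation (Ordinal hi)).
Qed.

Lemma size_arrivals sigma e t :
  size (arrivals sigma e (t + transit e)) = load sigma e t.
Proof.
rewrite size_filter addnK /load -count_generation // take_oversize //.
by rewrite size_generation.
Qed.

Lemma arrivals_early sigma e t : t <= transit e -> arrivals sigma e t = [::].
Proof.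
by move=> /eqP te; rewrite /arrivals (te : t - transit e = 0) generation0.
Qed.

Lemma waiting_early sigma e t : t <= transit e -> waiting sigma e t = [::].
Proof.
elim: t => [|t IHt] te; rewrite /= arrivals_early // cats0 //.
by rewrite IHt // ltnW.
Qed.

Definition held sigma e t : seq (player delta) :=
  if t is t'.+1 then waiting sigma e t' else [::].

(** The bridge from lists to counters: delayed by [transit e], the queue of [e] follows the
    single-server recursion, and it is empty until then. *)
Lemma size_held sigma e t :
  size (held sigma e (t + transit e)) = left_over sigma e t.
Proof.
elim: t => [|t IHt].
  rewrite add0n /held.
  by case: (transit e) (waiting_early sigma (e := e)) => // d ->.
rewrite addSn /= waitingE size_drop /queue size_cat size_arrivals.
by rewrite -[X in size X]/(held sigma e (t + transit e)) IHt.
Qed.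

Lemma departure_waiting sigma e t y :
  y \in waiting sigma e t -> departure y + transit e <= t.
Proof.
elim: t => [|t IHt]; first by rewrite waiting_early.
rewrite /= => /mem_drop; rewrite mem_cat => /orP[/IHt/leqW//|].
have [te|te] := leqP t.+1 (transit e); first by rewrite arrivals_early.
rewrite mem_filter => /andP[_ /departure_generation->].
by rewrite subnK // ltnW.
Qed.

(** While enough players are ahead, exactly [cap e] of them leave at each stage, and newcomers join
    behind. *)
Lemma queue_split sigma t (i : 'I_(inflow delta t)) e n :
    sigma (mk_player i) = e -> n * cap e <= rank sigma t i e ->
  exists s1 s2, [/\ queue sigma e (t + transit e + n) = s1 ++ mk_player i :: s2,
    size s1 = rank sigma t i e - n * cap e & mk_player i \notin s1].
Proof.
move=> sigE; elim: n => [|n IHn] rank_ge.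
  pose s := take i (generation delta t).
  exists (held sigma e (t + transit e) ++ [seq y <- s | sigma y == e]).
  exists [seq y <- drop i.+1 (generation delta t) | sigma y == e].
  rewrite addn0; split.
  - rewrite -catA /queue; congr (_ ++ _); rewrite /arrivals addnK.
    rewrite -{1}(cat_take_drop i (generation delta t)) filter_cat.
    congr (_ ++ _).
    rewrite (drop_nth (mk_player i)) ?size_generation // nth_generation /=.
    by rewrite sigE eqxx.
  - rewrite mul0n subn0 size_cat size_held size_filter count_generation //.
    exact: ltnW.
  - rewrite mem_cat negb_or; apply/andP; split.
      rewrite /held; case tE: (t + transit e) => [//|u].
      by apply/negP => /departure_waiting; rewrite /departure /= tE ltnn.
    rewrite mem_filter negb_and; apply/orP; right.
    have := generation_uniq t; rewrite -(cat_take_drop i (generation delta t)).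
    rewrite (drop_nth (mk_player i)) ?size_generation // nth_generation.
    by rewrite cat_uniq /= negb_or => /and3P[_ /andP[]].
have [|s1 [s2 [qE s1E s1P]]] := IHn; first by rewrite mulSn in rank_ge; lia.
have cap_s1 : cap e <= size s1 by rewrite s1E; rewrite mulSn in rank_ge; lia.
exists (drop (cap e) s1), (s2 ++ arrivals sigma e (t + transit e + n.+1)).
split.
- rewrite addnS /queue waitingE qE drop_cat.
  move: cap_s1; rewrite leq_eqVlt => /predU1P[->|->]; last by rewrite -catA.
  by rewrite ltnn subnn drop0 drop_size.
- by rewrite size_drop s1E mulSn; lia.
- by apply: contra s1P => /mem_drop.
Qed.

(** The exit occurs at the first [n] for which fewer than [cap e] players remain ahead, [n * cap e]
    having left. *)
Lemma waiting_costE sigma t (i : 'I_(inflow delta t))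
    (e := sigma (mk_player i)) :
  waiting_cost sigma (mk_player i) = rank sigma t i e %/ cap e.
Proof.
have cap_e := cap_gt0 e.
have exitsP n : n * cap e <= rank sigma t i e ->
    (mk_player i \in exits sigma e (reach_head sigma (mk_player i) + n)) =
    (rank sigma t i e - n * cap e < cap e).
  move=> rank_ge; have [s1 [s2 [qE s1E s1P]]] := queue_split (erefl e) rank_ge.
  rewrite /exits /reach_head /departure /= -/e qE -s1E.
  have [lt|ge] := ltnP (size s1) (cap e); last first.
    by rewrite takel_cat //; apply/negP => /mem_take; apply/negP.
  rewrite take_cat ltnNge (ltnW lt) /=.
  rewrite -(prednK (_ : 0 < cap e - size s1)) ?subn_gt0 //=.
  by rewrite mem_cat inE eqxx orbT.
rewrite /waiting_cost; case: ex_minnP => n n_exit n_min.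
have q_exit : mk_player i \in
    exits sigma e (reach_head sigma (mk_player i) + rank sigma t i e %/ cap e).
  by rewrite exitsP ?leq_trunc_div // {1}(divn_eq (rank sigma t i e) (cap e))
    addKn ltn_mod.
apply/eqP; rewrite eqn_leq n_min //= leqNgt; apply/negP => lt_n.
have le_n : n.+1 * cap e <= rank sigma t i e by rewrite -leq_divRL.
move: n_exit; rewrite -/e exitsP; first by rewrite mulSn in le_n; lia.
by rewrite mulSn in le_n; lia.
Qed.

Lemma latencyE sigma t (i : 'I_(inflow delta t))
    (e := sigma (mk_player i)) :
  latency sigma (mk_player i) = transit e + rank sigma t i e %/ cap e.
Proof. by rewrite /latency waiting_costE. Qed.

Lemma latency_deviate sigma t (i : 'I_(inflow delta t)) e :
  latency (deviate sigma (mk_player i) e) (mk_player i) =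
    transit e + rank sigma t i e %/ cap e.
Proof.
rewrite latencyE; have -> : deviate sigma (mk_player i) e (mk_player i) = e.
  by rewrite /deviate /= eqxx.
congr (_ + _ %/ _); apply: eq_rank => s j before; rewrite /deviate /=.
case: eqP => // jE; move: before.
(* If a player of higher priority were the deviating one, the generations and then the indices would
   agree, against strict priority. *)
have st := congr1 (@tag _ _) jE; rewrite /= in st.
case: _ / st i jE => i /mk_player_inj->.
by case=> [|[_]]; rewrite ltnn.
Qed.

Lemma nash_latency sigma : nash_equilibrium sigma <->
  forall t (i : 'I_(inflow delta t)) e,
    latency sigma (mk_player i) <= transit e + rank sigma t i e %/ cap e.
Proof.
split=> [nash t i e|nash [t i] e]; first by rewrite -latency_deviate.
by rewrite -[existT _ t i]/(mk_player i) latency_deviate.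
Qed.

(** The source is visited at departure on any route, and arrivals at the destination compare as
    latencies do. *)
Lemma ufr_nash sigma : ufr_equilibrium sigma <-> nash_equilibrium sigma.
Proof.
split=> [[]//|nash]; split=> // x [] e //=.
by rewrite leq_add2l.
Qed.

End Rank.

(** * Summation over periods *)

Lemma sum_nat_shift (f : nat -> nat) a b : a <= b ->
  \sum_(a <= t < b) f t.+1 + f a = \sum_(a <= t < b) f t + f b.
Proof.
move=> ab; rewrite -(big_nat_recr b a f ab) [in RHS]big_ltn ?ltnS //=.
by rewrite big_add1 addnC.
Qed.

(** Averages start at period 1, so the stages up to [K] are split off as a constant. *)
Lemma sum_nat_periods (f : nat -> nat) K P :
  \sum_(0 <= t < (P.+1 * K).+1) f t = \sum_(0 <= t < K.+1) f t +
    \sum_(1 <= p < P.+1) \sum_((p * K).+1 <= t < (p.+1 * K).+1) f t.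
Proof.
elim: P => [|P IHP]; first by rewrite [X in _ + X]big_geq // mul1n addn0.
rewrite [X in _ + X]big_nat_recr //= addnA -IHP -big_cat_nat //.
by rewrite ltnS leq_mul2r leqnSn orbT.
Qed.

Lemma leq_sum_late (f : nat -> nat) m T :
  \sum_(0 <= t < T) f t <=
    \sum_(0 <= t < T) (if m <= t then f t else 0) + \sum_(0 <= t < m) f t.
Proof.
have [Tm|mT] := leqP T m.
  by rewrite [X in _ + X](@big_cat_nat _ _ _ T) //=; lia.
rewrite [X in X <= _](@big_cat_nat _ _ _ m) ?(ltnW mT) //=.
rewrite [X in _ <= X + _](@big_cat_nat _ _ _ m) ?(ltnW mT) //=.
suff -> : \sum_(m <= t < T) f t =
    \sum_(m <= t < T) (if m <= t then f t else 0) by lia.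
by apply: eq_big_nat => t /andP[->].
Qed.

(** * The virtual server fed by the inflow *)

Section Game.
Variables (N : parallel_network) (K : nat) (delta : K.-tuple nat).
Hypothesis K_gt0 : 0 < K.
Hypothesis delta_inflow : delta \in inflow_vector K (capacity N).
Implicit Types (sigma : profile N delta) (e : edge N).

Local Notation gam := (capacity N).
Local Notation inf := (inflow delta).
Local Notation V := (backlog (fun t => inf t.+1) gam).
Local Notation B := (backlog inf gam).
Local Notation M := (\max_(e : edge N) transit e).
Local Notation cost := (\sum_(e : edge N) cap e * transit e).
Local Notation Phi := (\sum_(K <= t < K + K) V t).

Lemma inflow_periodic t : inf (t + K).+1 = inf t.+1.
Proof. by rewrite /= modnDr. Qed.

Lemma inflow_mean : \sum_(0 <= r < K) inf r.+1 = gam * K.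
Proof.
rewrite big_mkord; move/eqP: delta_inflow => <-; apply: eq_bigr => k _.
by rewrite /= modn_small // (tnth_nth 0).
Qed.

(** The dummy stage 0 breaks the periodicity of [inf]; [V] skips it, so that the periodic results
    apply, while [B] follows the numbering of stages. *)
Lemma virtual_backlogS t : B t.+1 = V t.
Proof. by elim: t => // t IHt; rewrite backlogS IHt. Qed.

Lemma inflow_capacity0 t : gam = 0 -> inf t = 0.
Proof.
move=> gam0; case: t => //= t; have tK : t %% K < K by rewrite ltn_mod.
move/eqP: delta_inflow; rewrite gam0 mul0n (bigD1 (Ordinal tK)) //=.
by rewrite (tnth_nth 0) /=; lia.
Qed.

Lemma virtual_no_waste t : K < t -> gam <= B t + inf t.
Proof.
case: t => // t Kt; rewrite virtual_backlogS.
by apply: backlog_no_waste inflow_periodic inflow_mean _ _ _ => //; lia.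
Qed.

Lemma virtual_backlog_periodic t j : K < t -> B (t + j * K) = B t.
Proof.
case: t => // t Kt; rewrite addSn !virtual_backlogS.
exact: backlog_periodicM inflow_periodic inflow_mean _ _ _ _.
Qed.

Lemma virtual_zero : exists2 z, K < z & B z = 0.
Proof.
have [z /andP[Kz _] Vz] := backlog_zero inflow_periodic inflow_mean K_gt0.
by exists z.+1; rewrite ?virtual_backlogS.
Qed.

Lemma virtual_sum p : 0 < p ->
  \sum_((p * K).+1 <= t < (p.+1 * K).+1) B t = Phi.
Proof.
move=> p_gt0; rewrite big_add1 /=; under eq_bigr do rewrite virtual_backlogS.
rewrite mulSn addnC.
rewrite (sum_backlog_period inflow_periodic inflow_mean _ (leqnn K)) //.
by rewrite leq_pmull.
Qed.

Lemma virtual_sumS p : 0 < p ->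
  \sum_((p * K).+1 <= t < (p.+1 * K).+1) B t.+1 = Phi.
Proof.
move=> p_gt0; under eq_bigr do rewrite virtual_backlogS.
rewrite mulSn addnC -addSn.
rewrite (sum_backlog_period inflow_periodic inflow_mean _ (leqnn K)) //.
by apply: leq_trans (leq_pmull K p_gt0) _.
Qed.

(** The backlogs are read in the second period, where no capacity is wasted; periodicity closes the
    cycle at its last stage. *)
Lemma excess_virtual :
  excess gam delta (fun k : 'I_K => B (k + K).+1).
Proof.
split=> [k|].
  have -> : tnth delta k = inf (k + K).+1.
    by rewrite inflow_periodic (tnth_nth 0) /= modn_small.
  have <- : B (k + K).+2 = B (ordS k + K).+1.
    rewrite /= -addSn; have [kK|Kk] := ltnP k.+1 K; first by rewrite modn_small.
    have -> : k.+1 = K by have := ltn_ord k; lia.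
    by rewrite modnn add0n -addSn -[X in _ + X]mul1n virtual_backlog_periodic.
  have := @virtual_no_waste (k + K).+1; rewrite ltnS leq_addl => /(_ isT).
  by rewrite [B _.+2]backlogS; lia.
have [z /andP[Kz zK] Vz] := backlog_zero inflow_periodic inflow_mean K_gt0.
have zK' : z - K < K by lia.
by exists (Ordinal zK'); rewrite virtual_backlogS /= subnK.
Qed.

Lemma uniform_distance_virtual (R : realType) :
  uniform_distance R gam delta = (Phi%:R)%R%:E.
Proof.
rewrite (uniform_distance_excess R delta_inflow excess_virtual).
have -> : Phi = \sum_(0 <= k < K) V (k + K).
  by rewrite -{1}[K]add0n big_addn addnK.
congr ((_%:R)%R%:E); rewrite big_mkord.
by apply: eq_bigr => k _; rewrite virtual_backlogS.
Qed.

(* [div_sum gam] of the backlog is a potential: up to its variation, the waiting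
   times of a generation add up to the backlog it leaves behind. *)
Lemma virtual_wait_stage t :
  \sum_(i < inf t) (B t + i) %/ gam + div_sum gam (B t) =
    div_sum gam (B t.+1) + B t.+1.
Proof.
have [gam0|gam_gt0] := posnP gam.
  have inf0 := inflow_capacity0 ^~ gam0.
  have B0 s : B s = 0 by elim: s => // s IHs; rewrite backlogS IHs inf0.
  rewrite !B0 big1 ?addn0 // => i _.
  by have := ltn_ord i; rewrite [X in _ < X]inf0.
by rewrite addnC -div_sumD (div_sumB _ gam_gt0).
Qed.

(** [B] returns to its value after a period, so the potential cancels. *)
Lemma virtual_wait_period p : 0 < p ->
  \sum_((p * K).+1 <= t < (p.+1 * K).+1)
    \sum_(i < inf t) (B t + i) %/ gam = Phi.
Proof.
move=> p_gt0; set a := (p * K).+1; set b := (p.+1 * K).+1.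
have ab : a <= b by rewrite ltnS leq_mul2r leqnSn orbT.
have Bab : B b = B a.
  have -> : b = a + 1 * K by rewrite /b mulSn mul1n addnC.
  by rewrite virtual_backlog_periodic // ltnS leq_pmull.
have := sum_nat_shift (fun t => div_sum gam (B t)) ab.
rewrite Bab => /addIn shift.
apply: (@addIn (\sum_(a <= t < b) div_sum gam (B t))).
rewrite -big_split /=; under eq_bigr do rewrite virtual_wait_stage.
by rewrite big_split /= shift addnC virtual_sumS.
Qed.

Lemma sum_inflow_period p :
  \sum_((p * K).+1 <= t < (p.+1 * K).+1) inf t = K * gam.
Proof.
rewrite big_add1 /= mulSn addnC.
by rewrite (sum_period inflow_periodic inflow_mean) mulnC.
Qed.

(** * Latency accounting and the lower bound for all profiles *)

(** The potential argument edge by edge: the waits on [e] are quotients of consecutive ranks and add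
    up to an increment of [div_sum]. *)
Lemma stage_latencyE sigma t :
  stage_latency sigma t + \sum_e div_sum (cap e) (left_over sigma e t) =
    \sum_e (transit e * load sigma e t + left_over sigma e t.+1 +
            div_sum (cap e) (left_over sigma e t.+1)).
Proof.
transitivity (\sum_e (transit e * load sigma e t +
    div_sum (cap e) (rank sigma t (inf t) e))); last first.
  apply: eq_bigr => e _; rewrite (div_sumB _ (cap_gt0 e)) -left_overS; lia.
have -> : stage_latency sigma t =
    \sum_(j < inf t | j < inf t) latency sigma (mk_player j).
  by apply: eq_bigl => j; rewrite ltn_ord.
suff prefix i : i <= inf t ->
    \sum_(j < inf t | j < i) latency sigma (mk_player j) +
      \sum_e div_sum (cap e) (left_over sigma e t) =
    \sum_e (transit e * joined sigma t i e +
            div_sum (cap e) (rank sigma t i e)).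
  exact: prefix.
elim: i => [|i IHi] hi.
  rewrite [X in X + _]big_pred0 // add0n; apply: eq_bigr => e _.
  by rewrite joined0 muln0 rank0.
rewrite (sum_ord_ltS hi) addnAC IHi ?(ltnW hi) // latencyE /=.
set x := mk_player _.
rewrite (bigD1 (sigma x)) //= [in RHS](bigD1 (sigma x)) //=.
rewrite (joinedS sigma (Ordinal hi)) (rankS sigma (Ordinal hi)) eqxx addn1.
rewrite addn1 div_sumS mulnS.
under [in RHS]eq_bigr => e neq do rewrite (joinedS sigma (Ordinal hi))
  (rankS sigma (Ordinal hi)) eq_sym (negbTE neq) !addn0.
by rewrite /=; lia.
Qed.

Lemma sum_stage_latency sigma T :
  \sum_(0 <= t < T) stage_latency sigma t =
    \sum_e (transit e * \sum_(0 <= t < T) load sigma e t +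
      \sum_(0 <= t < T) left_over sigma e t.+1 +
      div_sum (cap e) (left_over sigma e T)).
Proof.
elim: T => [|T IHT].
  rewrite big_geq // big1 // => e _.
  by rewrite !big_geq // muln0 /div_sum big_ord0.
apply: (@addIn (\sum_e div_sum (cap e) (left_over sigma e T))).
rewrite big_nat_recr //= -addnA stage_latencyE IHT -!big_split /=.
by apply: eq_bigr => e _; rewrite !big_nat_recr //= mulnDr; lia.
Qed.

Lemma sum_loads sigma a b :
  \sum_e \sum_(a <= t < b) load sigma e t = \sum_(a <= t < b) inf t.
Proof. by rewrite exchange_big /=; apply: eq_bigr => t _; rewrite sum_load. Qed.

(* With the last sum moved to the left, the left-hand side adds up over [t] the
   number of players travelling or queueing at stage [t]. *)
Lemma in_system_latency sigma T :
  \sum_(0 <= t < T) \sum_e (\sum_(0 <= r < t) load sigma e r +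
      left_over sigma e (t - transit e)) <=
    \sum_(0 <= t < T) stage_latency sigma t +
    \sum_(0 <= t < T) \sum_e \sum_(0 <= r < t - transit e) load sigma e r.
Proof.
rewrite sum_stage_latency exchange_big /= [X in _ + X]exchange_big /=.
rewrite -big_split /=.
apply: leq_sum => e _; rewrite big_split /=.
pose A t := \sum_(0 <= r < t) load sigma e r.
have A_mono : {homo A : s t / s <= t}.
  by move=> s t st; rewrite /A [X in _ <= X](@big_cat_nat _ _ _ s) //= leq_addr.
have A0 : A 0 = 0 by rewrite /A big_geq.
have left0 : left_over sigma e 0 = 0 by [].
have := sum_lag_mono (transit e) T A0 A_mono.
have := sum_lag_le (transit e) T left0.
have := sum_nat_shift (left_over sigma e) (leq0n T).
by rewrite /A; lia.
Qed.

(** From [z] on, [e] releases at most [cap e * (t - transit e - z)] players, which is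
    [cap e * transit e] short of [cap e * (t - z)]. The single server, empty at [z] and wasting
    nothing, releases exactly [gam * (t - z)]. *)
Lemma in_system_lower sigma z t : K < z -> B z = 0 -> z + M <= t ->
  \sum_e left_over sigma e z + cost + B t +
    \sum_e \sum_(0 <= r < t - transit e) load sigma e r <=
  \sum_e (\sum_(0 <= r < t) load sigma e r + left_over sigma e (t - transit e)).
Proof.
move=> Kz Bz zt.
have edge_bound e : left_over sigma e z + cap e * transit e +
      \sum_(0 <= r < t - transit e) load sigma e r <=
    left_over sigma e (t - transit e) + \sum_(0 <= r < z) load sigma e r +
      cap e * (t - z).
  have te : transit e <= M by apply: leq_bigmax.
  have ze : z <= t - transit e by lia.
  have := backlog_lower (load sigma e) (cap e) ze.
  rewrite -/(left_over sigma e).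
  rewrite [\sum_(0 <= r < t - _) _](@big_cat_nat _ _ _ z) //=.
  have -> : t - z = t - transit e - z + transit e by lia.
  by rewrite mulnDr; lia.
have bound := leq_sum (index_enum (edge N)) (fun e (_ : true) => edge_bound e).
rewrite !big_split /= -big_distrl /= -/(capacity N) !sum_loads in bound.
have zt' : z <= t by lia.
have no_waste r : z <= r < t -> gam <= B r + inf r.
  by move=> /andP[zr _]; apply: virtual_no_waste; lia.
have := backlog_conserved zt' no_waste; rewrite Bz => conserved.
rewrite [X in _ <= X]big_split /= sum_loads.
rewrite [\sum_(0 <= r < t) inf r](@big_cat_nat _ _ _ z) //=.
lia.
Qed.

(** The queue term is dropped for the optimum, but supplies the extra cost of the worst
    equilibrium. *)
Lemma period_latency_lower sigma z : K < z -> B z = 0 ->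
  exists C, forall P,
    P * (K * (\sum_e left_over sigma e z + cost) + Phi) <=
      \sum_(1 <= p < P.+1) period_latency sigma p + C.
Proof.
move=> Kz Bz; set c := (\sum_e _ + _).
exists (\sum_(0 <= t < K.+1) stage_latency sigma t +
  \sum_(0 <= t < z + M) (c + B t)) => P.
have := in_system_latency sigma (P.+1 * K).+1.
have := leq_sum_late (fun t => c + B t) (z + M) (P.+1 * K).+1.
rewrite !(sum_nat_periods _ K P).
have -> : \sum_(1 <= p < P.+1)
    \sum_((p * K).+1 <= t < (p.+1 * K).+1) (c + B t) = P * (K * c + Phi).
  rewrite (eq_big_nat _ _ (F2 := fun=> K * c + Phi)); last first.
    move=> p /andP[p_gt0 _]; rewrite big_split /= virtual_sum //.
    by rewrite sum_nat_const_nat mulSn subSS addnK.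
  by rewrite sum_nat_const_nat subn1.
rewrite -!(sum_nat_periods _ K P).
have : \sum_(0 <= t < (P.+1 * K).+1) ((if z + M <= t then c + B t else 0) +
     \sum_e \sum_(0 <= r < t - transit e) load sigma e r) <=
  \sum_(0 <= t < (P.+1 * K).+1) \sum_e (\sum_(0 <= r < t) load sigma e r +
     left_over sigma e (t - transit e)).
  apply: leq_sum => t _; case: ifP => [zt|_]; first exact: in_system_lower.
  rewrite add0n; apply: leq_sum => e _.
  rewrite [X in _ <= X + _](@big_cat_nat _ _ _ (t - transit e)) ?leq_subr //=.
  by lia.
rewrite big_split /= (sum_nat_periods (stage_latency sigma)).
rewrite /period_latency; lia.
Qed.

(** * An optimal profile by cyclic dispatch *)

Section OptimalProfile.
Variable e0 : edge N.

Definition slots : seq (edge N) :=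
  flatten [seq nseq (cap e) e | e <- index_enum (edge N)].

Definition slot (m : nat) : edge N := nth e0 slots (m %% gam).

Lemma sum_slots (phi : edge N -> nat) :
  \sum_(x <- slots) phi x = \sum_e cap e * phi e.
Proof.
rewrite big_flatten big_map; apply: eq_bigr => e _.
by rewrite big_nseq iter_addn_0 mulnC.
Qed.

Lemma size_slots : size slots = gam.
Proof.
by rewrite -sum1_size sum_slots; apply: eq_bigr => e _; rewrite muln1.
Qed.

Lemma sum_slotD (phi : edge N -> nat) m :
  \sum_(j < m + gam) phi (slot j) =
    \sum_(j < m) phi (slot j) + \sum_e cap e * phi e.
Proof.
rewrite addnC big_split_ord /= addnC; congr (_ + _).
  by apply: eq_bigr => j _; rewrite /slot modnDl.
rewrite -sum_slots (big_nth e0) size_slots big_mkord.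
by apply: eq_bigr => j _; rewrite /slot modn_small.
Qed.

Definition slot_count (e : edge N) (m : nat) : nat :=
  \sum_(j < m) (slot j == e).

Lemma slot_countS e m : slot_count e m.+1 = slot_count e m + (slot m == e).
Proof. exact: big_ord_recr. Qed.

Lemma slot_countD e m : slot_count e (m + gam) = slot_count e m + cap e.
Proof.
rewrite [LHS](sum_slotD (fun x => x == e : nat)); congr (_ + _).
rewrite (bigD1 e) //= eqxx muln1 big1 ?addn0 // => x /negbTE->.
by rewrite muln0.
Qed.

Lemma leq_slot_count e m : m <= gam -> slot_count e m <= cap e.
Proof.
have <- : slot_count e gam = cap e.
  by have := slot_countD e 0; rewrite add0n {2}/slot_count big_ord0.
elim: gam m => [|g IHg] m; first by rewrite leqn0 => /eqP->.
rewrite leq_eqVlt => /predU1P[->//|]; rewrite ltnS => /IHg.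
by rewrite slot_countS => /leq_trans; apply; apply: leq_addr.
Qed.

(** A stage of service removes [gam] positions from the virtual queue and [cap e] from the share of
    [e], truncation included, so both recursions stay in step. *)
Lemma slot_countB e m : slot_count e (m - gam) = slot_count e m - cap e.
Proof.
have [le_gam|/ltnW lt_gam] := leqP gam m.
  by rewrite -{2}(subnK le_gam) slot_countD addnK.
have /eqP-> : slot_count e m - cap e == 0 by apply: leq_slot_count.
by rewrite (eqP lt_gam) /slot_count big_ord0.
Qed.

(** Each full block before [m] holds [cap e] positions of [e]; the partial one holds fewer, since
    position [m] itself belongs to [e]. So the wait on [e] equals the virtual one. *)
Lemma slot_count_div e m : 0 < gam -> slot m = e ->
  slot_count e m %/ cap e = m %/ gam.
Proof.
move=> gam_gt0 slotE; set q := m %/ gam; set r := m %% gam.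
have -> : slot_count e m = q * cap e + slot_count e r.
  rewrite [in LHS](divn_eq m gam) -/q -/r; elim: q => // q IHq.
  by rewrite mulSn -addnA addnC slot_countD IHq mulSn; lia.
have r_lt : r < gam by rewrite ltn_mod.
rewrite divnMDl ?cap_gt0 // divn_small ?addn0 //.
have := leq_slot_count e r_lt; rewrite slot_countS.
by have -> : slot r = e; [rewrite -slotE /slot modn_mod | rewrite eqxx addn1].
Qed.

Definition slot_profile : profile N delta :=
  fun x => slot (B (tag x) + tagged x).

Lemma rank_slot_profile t i e : i <= inf t ->
  rank slot_profile t i e = slot_count e (B t + i).
Proof.
elim: t i => [|t IHt] i.
  by rewrite leqn0 => /eqP->; rewrite rank0 /slot_count big_ord0.
elim: i => [|i IHi] hi.
  by rewrite rank0 left_overS IHt // addn0 backlogS slot_countB.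
by rewrite (rankS _ (Ordinal hi)) IHi ?(ltnW hi) // addnS slot_countS.
Qed.

Lemma latency_slot_profile t (i : 'I_(inf t)) : 0 < gam ->
  latency slot_profile (mk_player i) =
    transit (slot (B t + i)) + (B t + i) %/ gam.
Proof.
move=> gam_gt0; rewrite latencyE rank_slot_profile ?(ltnW (ltn_ord i)) //.
by rewrite slot_count_div.
Qed.

Lemma period_latency_slot_profile p : 0 < gam -> 0 < p ->
  period_latency slot_profile p = K * cost + Phi.
Proof.
move=> gam_gt0 p_gt0; rewrite -(virtual_wait_period p_gt0).
set a := (p * K).+1; set b := (p.+1 * K).+1.
have ab : a <= b by rewrite ltnS leq_mul2r leqnSn orbT.
rewrite /period_latency -/a -/b.
under eq_bigr => t _ do (rewrite /stage_latency; under eq_bigr => i _ do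
  rewrite latency_slot_profile //; rewrite big_split /=).
rewrite big_split /=; congr (_ + _).
(* A potential for transit costs: without waste, the positions filled at stage [t] run from [B t] to
   [B t.+1 + gam], so up to the variation of [H] they cost one full block. *)
pose H m := \sum_(j < m) transit (slot j).
have Bab : B b = B a.
  have -> : b = a + 1 * K by rewrite /b mulSn mul1n addnC.
  by rewrite virtual_backlog_periodic // ltnS leq_pmull.
have := sum_nat_shift (fun t => H (B t)) ab; rewrite Bab => /addIn shift.
apply: (@addIn (\sum_(a <= t < b) H (B t))); rewrite -big_split /=.
rewrite (eq_big_nat _ _ (F2 := fun t => cost + H (B t.+1))).
  rewrite big_split /= shift sum_nat_const_nat; congr (_ * _ + _).
  by rewrite /b mulSn subSS addnK.
move=> t /andP[at_ _]; rewrite addnC.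
have -> : H (B t) + \sum_(i < inf t) transit (slot (B t + i)) = H (B t + inf t).
  by rewrite /H big_split_ord.
have <- : B t.+1 + gam = B t + inf t.
  rewrite backlogS subnK // virtual_no_waste //.
  by apply: leq_trans at_; rewrite ltnS leq_pmull.
by rewrite /H (sum_slotD (fun e => transit e)) addnC.
Qed.

End OptimalProfile.

Lemma capacity0_virtual : gam = 0 -> Phi = 0.
Proof.
move=> gam0; rewrite big1 // => t _; rewrite -virtual_backlogS.
by elim: t.+1 => // s IHs; rewrite backlogS IHs inflow_capacity0.
Qed.

Lemma capacity0_cost : gam = 0 -> cost = 0.
Proof.
move=> gam0; apply: big1 => e _; have := cap_gt0 e.
by have := gam0; rewrite /capacity (bigD1 e) //=; lia.
Qed.

Lemma capacity0_profile : gam = 0 -> exists sigma : profile N delta, True.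
Proof.
move=> gam0; suff noplayer : player delta -> False.
  by exists (fun x => False_rect _ (noplayer x)).
by move=> [t [i]]; rewrite inflow_capacity0.
Qed.

Lemma capacity0_period sigma p : gam = 0 -> period_latency sigma p = 0.
Proof.
move=> gam0; apply: big1 => t _; apply: big1 => i _.
by have := ltn_ord i; rewrite [X in _ < X]inflow_capacity0.
Qed.

Lemma capacity_gt0_edge : 0 < gam -> exists e : edge N, true.
Proof.
move=> gam_gt0; have [e _|no_edge] := pickP (fun _ : edge N => true).
  by exists e.
by rewrite /capacity big_pred0 in gam_gt0.
Qed.

Lemma exists_optimal_profile : exists sigma : profile N delta,
  forall p, 0 < p -> period_latency sigma p = K * cost + Phi.
Proof.
have [gam0|gam_gt0] := posnP gam.
  have [sigma _] := capacity0_profile gam0; exists sigma => p _.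
  by rewrite capacity0_period // capacity0_cost // capacity0_virtual // muln0.
have [e0 _] := capacity_gt0_edge gam_gt0.
by exists (slot_profile e0) => p; apply: period_latency_slot_profile.
Qed.

(** * Balanced queues and the upper bound for equilibria *)

Section Balance.
Variables (c : edge N -> edge N -> nat).

(* If the slot of [e] exiting [k + transit e] stages after departure is taken,
   then so are all the earlier slots of the other edges; [c e e' = 1] asks this
   also for the slots of [e'] at that very stage. *)
Definition balanced (n : edge N -> nat) : Prop := forall e e' k,
  cap e * k < n e -> cap e' * (k + transit e + c e e' - transit e') <= n e'.

(** Induction over the players by priority. Service shifts the slots of all edges by one; a player
    taking a new slot of [e] shows, by preferring [e], that the required slots of [e'] are taken. *)
Lemma balanced_rank sigma :
    (forall t (i : 'I_(inf t)) e,
      latency sigma (mk_player i) + c (sigma (mk_player i)) e <=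
        transit e + rank sigma t i e %/ cap e) ->
  forall t i, i <= inf t -> balanced (rank sigma t i).
Proof.
move=> best; elim=> [|t IHt]; elim=> [|i IHi] hi e e' k.
- by rewrite !rank0.
- by move: hi; rewrite ltn0.
- rewrite !rank0 !left_overS ltn_subRL -mulnS => /(IHt _ (leqnn _) e e').
  set d := k + transit e + c e e' - transit e'.
  have [le|gt] := leqP (transit e') (k + transit e + c e e'); last first.
    by move=> _; have -> : d = 0; [rewrite /d; lia | rewrite muln0].
  have -> : k.+1 + transit e + c e e' - transit e' = d.+1 by rewrite /d; lia.
  by rewrite mulnS; lia.
- rewrite !(rankS _ (Ordinal hi)) /= => lt_k.
  have [lt_k'|le_k] := ltnP (cap e * k) (rank sigma t.+1 i e).
    by apply: leq_trans (leq_addr _ _); apply: (IHi (ltnW hi)).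
  have sigE : sigma (mk_player (Ordinal hi)) = e.
    by apply/eqP; move: lt_k le_k; case: eqP => //=; lia.
  have := best _ (Ordinal hi) e'; rewrite latencyE sigE /= => best_e.
  apply: leq_trans (leq_addr _ _); rewrite mulnC -leq_divRL ?cap_gt0 //.
  have : k <= rank sigma t.+1 i e %/ cap e.
    by rewrite leq_divRL ?cap_gt0 // mulnC; move: lt_k; rewrite sigE eqxx; lia.
  move: best_e; move: (_ %/ cap e) (_ %/ cap e') => q q'.
  by lia.
Qed.

End Balance.

Local Notation slack := (\sum_(e : edge N) cap e * (M - transit e)).

(** [slack] is the total queue length that raises every edge to latency [M]. *)
Lemma slack_cost : slack + cost = gam * M.
Proof.
rewrite -big_split /= big_distrl /=; apply: eq_bigr => e _.
by rewrite -mulnDr subnK // leq_bigmax.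
Qed.

(** If every edge is used to capacity, the queues change by the inflow minus [gam], and [B] by at
    least as much. Otherwise some slot is lost, and balance leaves at most [cap e * (M - transit e)]
    players on each [e]. *)
Lemma nash_left_over sigma t : nash_equilibrium sigma ->
  \sum_e left_over sigma e t <= slack + B t.
Proof.
move=> /nash_latency nash.
have bal : forall t i, i <= inf t -> balanced (fun _ _ => 0) (rank sigma t i).
  by apply: balanced_rank => s i e; rewrite addn0.
elim: t => [|t IHt]; first by rewrite big1.
have [/forallP full|] := boolP [forall e, cap e <= rank sigma t (inf t) e].
  have : \sum_e left_over sigma e t.+1 + gam = \sum_e rank sigma t (inf t) e.
    rewrite -big_split /=; apply: eq_bigr => e _.
    by rewrite left_overS subnK.
  rewrite sum_rank // backlogS; lia.
rewrite negb_forall => /existsP[e0]; rewrite -ltnNge => lt_e0.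
apply: leq_trans (leq_addr _ _); apply: leq_sum => e _; rewrite left_overS.
rewrite leq_subLR -mulnS leqNgt; apply/negP => /(bal _ _ (leqnn _) e e0).
have te0 : transit e0 <= M by apply: leq_bigmax.
have te : transit e <= M by apply: leq_bigmax.
have : cap e0 * 1 <= cap e0 * ((M - transit e).+1 + transit e + 0 - transit e0).
  by rewrite leq_mul2l; apply/orP; right; lia.
by rewrite muln1; lia.
Qed.

(** A latency [l] above [M] requires a rank of at least [cap e * (l - transit e)] on every [e];
    summing gives [slack + gam * (l - M)], against at most [slack + B t + i] players present. *)
Lemma nash_latency_upper sigma t (i : 'I_(inf t)) : nash_equilibrium sigma ->
  latency sigma (mk_player i) <= M + (B t + i) %/ gam.
Proof.
move=> nash; set l := latency _ _.
have gam_gt0 : 0 < gam.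
  apply: leq_trans (cap_gt0 (sigma (mk_player i))) _.
  by rewrite /capacity (bigD1 (sigma (mk_player i))) //= leq_addr.
have [|/ltnW Ml] := leqP l M; first by move/leq_trans; apply; apply: leq_addr.
rewrite -leq_subLR leq_divRL // -(leq_add2l slack) addnA.
apply: leq_trans (_ : \sum_e rank sigma t i e <= _); last first.
  by rewrite sum_rank ?(ltnW (ltn_ord i)) // leq_add2r nash_left_over.
rewrite mulnC big_distrl -big_split /=; apply: leq_sum => e _.
have te : transit e <= M by apply: leq_bigmax.
rewrite -mulnDr; have -> : M - transit e + (l - M) = l - transit e by lia.
rewrite mulnC -leq_divRL ?cap_gt0 // leq_subLR.
exact: (proj1 (nash_latency sigma) nash).
Qed.

Lemma nash_period_upper sigma p : nash_equilibrium sigma -> 0 < p ->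
  period_latency sigma p <= K * gam * M + Phi.
Proof.
move=> nash p_gt0; rewrite -(virtual_wait_period p_gt0) -(sum_inflow_period p).
rewrite big_distrl -big_split /=; apply: leq_sum => t _.
rewrite -[X in X * _]card_ord -sum_nat_const -big_split /=.
by apply: leq_sum => i _; apply: nash_latency_upper.
Qed.

(** * An equilibrium of maximal cost *)

Section GreedyProfile.
Variable e0 : edge N.

Definition greedy_key (n : edge N -> nat) e : nat :=
  (transit e + n e %/ cap e) * M.+1 + transit e.

(* [greedy_key] compares latencies, breaking ties by the free-flow cost. *)
Definition greedy_edge (n : edge N -> nat) : edge N :=
  [arg min_(e < e0) greedy_key n e].

Lemma greedy_edgeP n (e := greedy_edge n) e' :
  transit e + n e %/ cap e + (transit e' < transit e) <=
    transit e' + n e' %/ cap e'.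
Proof.
rewrite /e /greedy_edge; case: arg_minnP => //= {}e _ /(_ e' isT).
rewrite /greedy_key; set l := transit e + _; set l' := transit e' + _.
have te : transit e <= M by apply: leq_bigmax.
have te' : transit e' <= M by apply: leq_bigmax.
move=> key_le; have [lt_l|le_l] := ltnP l' l.
  have : l'.+1 * M.+1 <= l * M.+1 by rewrite leq_mul2r lt_l orbT.
  by rewrite mulSn; lia.
have [lt_t|] := ltnP (transit e') (transit e); last by lia.
have [//|le_l'] := ltnP l l'; first by lia.
have lE : l = l' by lia.
by rewrite lE in key_le; lia.
Qed.

Definition greedy_add (n : edge N -> nat) : edge N -> nat :=
  fun e => n e + (greedy_edge n == e).

(** Queue lengths are computed along with the choices, since [rank] presupposes a complete profile;
    [rank_greedy] reconciles the two. *)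
Fixpoint greedy_start (t : nat) : edge N -> nat :=
  if t is t'.+1
  then fun e => iter (inf t') greedy_add (greedy_start t') e - cap e
  else fun=> 0.

Definition greedy : profile N delta :=
  fun x => greedy_edge (iter (tagged x) greedy_add (greedy_start (tag x))).

Lemma rank_greedy t i e : i <= inf t ->
  rank greedy t i e = iter i greedy_add (greedy_start t) e.
Proof.
elim: t i e => [|t IHt] i; elim: i => [|i IHi] e hi.
- by rewrite rank0.
- by move: hi; rewrite ltn0.
- by rewrite rank0 left_overS IHt.
- by rewrite (rankS _ (Ordinal hi)) IHi // ltnW.
Qed.

Lemma greedy_best t (i : 'I_(inf t)) e :
  latency greedy (mk_player i) + (transit e < transit (greedy (mk_player i))) <=
    transit e + rank greedy t i e %/ cap e.
Proof.
rewrite latencyE !rank_greedy ?(ltnW (ltn_ord i)) //.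
exact: greedy_edgeP.
Qed.

Lemma greedy_nash : nash_equilibrium greedy.
Proof.
apply/nash_latency => t i e; apply: leq_trans (greedy_best i e).
exact: leq_addr.
Qed.

(** A slot of latency [M] is taken on a longest edge [e1]. Ties favour shorter edges, so all their
    slots up to latency [M] are taken too, one more stage of capacity than is needed after
    service. *)
Lemma greedy_full t : (forall e, cap e <= rank greedy t (inf t) e) ->
  slack <= \sum_e left_over greedy e t.+1.
Proof.
move=> full; have [|e1 ME] := eq_bigmax (@transit N).
  by apply/card_gt0P; exists e0.
apply: leq_sum => e _; rewrite left_overS -(leq_add2r (cap e)) subnK //.
have te : transit e <= M by apply: leq_bigmax.
have [lt_e|ge_e] := ltnP (transit e) M; last first.
  by have -> : M - transit e = 0; [lia | rewrite muln0 add0n].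
have := @balanced_rank (fun e e' => transit e' < transit e) greedy greedy_best
  _ _ (leqnn (inf t)) e1 e 0.
rewrite muln0 -ME lt_e (leq_trans (cap_gt0 e1)) // => /(_ isT).
have -> : 0 + M + true - transit e = (M - transit e).+1 by lia.
by rewrite mulnS; lia.
Qed.

Lemma sum_inflow a : 0 < a -> \sum_(a <= r < a + K) inf r = gam * K.
Proof.
case: a => // a _; rewrite big_add1 /=.
exact: sum_period inflow_periodic inflow_mean _.
Qed.

(* Each period either ends with all short slots taken or wastes some capacity,
   and every wasted unit raises the total queue length seen a period later. *)
Lemma greedy_fill z j : K < z ->
  minn j slack <= \sum_e left_over greedy e (z + j * K).
Proof.
move=> Kz; elim: j => [|j IHj]; first by rewrite min0n.
set a := z + j * K in IHj *.
have -> : z + j.+1 * K = a + K by rewrite /a mulSn; lia.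
have a_gt0 : 0 < a by rewrite /a; lia.
pose t := (a + K).-1; have tE : t.+1 = a + K by rewrite /t; lia.
have [/forallP full|] := boolP [forall e, cap e <= rank greedy t (inf t) e].
  by rewrite -tE; apply: leq_trans (geq_minr _ _) (greedy_full full).
rewrite negb_forall => /existsP[e1]; rewrite -ltnNge => lt_e1.
suff : \sum_e left_over greedy e a < \sum_e left_over greedy e (a + K) by lia.
have edge_bound e :
    left_over greedy e a + \sum_(a <= r < a + K) load greedy e r + (e == e1) <=
      left_over greedy e (a + K) + cap e * K.
  have at_ : a <= t by rewrite /t; lia.
  have := backlog_lower (load greedy e) (cap e) at_.
  rewrite -/(left_over greedy e) -tE big_nat_recr //= left_overS.
  have -> : cap e * K = cap e + cap e * (t - a).
    by rewrite -mulnS; congr (_ * _); rewrite /t; lia.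
  rewrite /rank -/(load greedy e t).
  case: eqP => [->|_] /=; move: lt_e1; rewrite /rank -/(load greedy e1 t); lia.
have := leq_sum (index_enum (edge N)) (fun e (_ : true) => edge_bound e).
rewrite !big_split /= -big_distrl /= -/(capacity N) sum_loads sum_inflow //.
rewrite [\sum_(e : edge N) (e == e1)](bigD1 e1) //= eqxx; lia.
Qed.

End GreedyProfile.

Lemma exists_greedy_profile : exists2 sigma : profile N delta,
  nash_equilibrium sigma & exists C, forall P,
    P * (K * gam * M + Phi) <= \sum_(1 <= p < P.+1) period_latency sigma p + C.
Proof.
have [gam0|gam_gt0] := posnP gam.
  have [sigma _] := capacity0_profile gam0; exists sigma.
    by move=> [t i]; have := ltn_ord i; rewrite [X in _ < X]inflow_capacity0.
  by exists 0 => P; rewrite capacity0_virtual // gam0 !(muln0, mul0n).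
have [e0 _] := capacity_gt0_edge gam_gt0; have [z Kz Bz] := virtual_zero.
exists (greedy e0); first exact: greedy_nash.
(* After [slack] further periods the queues total at least [slack], and [B] vanishes again by
   periodicity. *)
have [||C lower] := @period_latency_lower (greedy e0) (z + slack * K).
- by apply: leq_trans (leq_addr _ _).
- by rewrite virtual_backlog_periodic.
exists C => P; apply: leq_trans (lower P).
rewrite leq_mul2l leq_add2r -mulnA leq_mul2l -slack_cost leq_add2r.
by have := greedy_fill e0 slack Kz; rewrite minnn => ->; rewrite !orbT.
Qed.

End Game.

Import Order.TTheory GRing.Theory Num.Theory numFieldNormedType.Exports.

(** * Limits of average latencies *)

Section AverageLatency.
Local Open Scope ring_scope.
Local Open Scope ereal_scope.
Local Open Scope classical_set_scope.
Variable R : realType.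
Implicit Types (u v : (\bar R)^nat).

Lemma le_limn_einf u v : (forall n, u n <= v n) -> limn_einf u <= limn_einf v.
Proof.
move=> le_uv; rewrite !limn_einf_lim.
apply: lee_lim; try exact: is_cvg_einfs.
apply: nearW => n; apply: le_ereal_inf_tmp => _ [p /= np <-].
by apply: le_trans (le_uv p); apply: ereal_inf_lbound; exists p.
Qed.

Lemma le_limn_esup u v : (forall n, u n <= v n) -> limn_esup u <= limn_esup v.
Proof.
move=> le_uv; rewrite -leeN2 -!limn_einfN; apply: le_limn_einf => n /=.
by rewrite leeN2.
Qed.

Lemma limn_einf_esup_cvg u l : l <= limn_einf u -> limn_esup u <= l ->
  u @ \oo --> l.
Proof.
move=> l_inf sup_l; have inf_sup := limn_einf_sup u.
have infE : limn_einf u = l.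
  by apply/le_anti; rewrite l_inf (le_trans inf_sup sup_l).
have supE : limn_esup u = l.
  by apply/le_anti; rewrite sup_l (le_trans l_inf inf_sup).
apply: (@squeeze_cvge _ _ _ _ (einfs u) u (esups u)).
- apply: nearW => n; apply/andP; split.
    by apply: ereal_inf_lbound; exists n => /=.
  by apply: ereal_sup_ubound; exists n => /=.
- by rewrite -infE limn_einf_lim; apply: is_cvg_einfs.
- by rewrite -supE limn_esup_lim; apply: is_cvg_esups.
Qed.

Variables (N : parallel_network) (K : nat) (delta : K.-tuple nat).
Implicit Types (sigma : profile N delta) (c C : nat).

Lemma limn_esup_avg_latency sigma c :
    (forall p, (0 < p)%N -> (period_latency sigma p <= c)%N) ->
  limn_esup (avg_latency R sigma) <= c%:R%:E.
Proof.
move=> le_c; have cvg_c : (fun=> c%:R%:E : \bar R) @ \oo --> (c%:R%:E : \bar R).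
  exact: cvg_cst.
rewrite -(cvg_limn_einf_sup cvg_c).2; apply: le_limn_esup => P.
rewrite lee_fin; have [->|P_gt0] := posnP P; first by rewrite invr0 mul0r ler0n.
rewrite ler_pdivrMl ?ltr0n // -natrM ler_nat.
have -> : (P * c)%N = (\sum_(1 <= p < P.+1) c)%N.
  by rewrite sum_nat_const_nat subn1.
rewrite !big_nat; apply: leq_sum => p /andP[p_gt0 _]; exact: le_c.
Qed.

Lemma limn_einf_avg_latency sigma c C :
    (forall P, (P * c <= \sum_(1 <= p < P.+1) period_latency sigma p + C)%N) ->
  c%:R%:E <= limn_einf (avg_latency R sigma).
Proof.
(* At [P = 0] the average is 0 by the convention for the inverse, and the term [c] makes [v 0]
   nonpositive; the factor 2 comes from [P.+1 <= 2 * P] for positive [P]. *)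
move=> ge_c; pose v P : \bar R := (c%:R - (c + 2 * C)%:R * P.+1%:R^-1)%R%:E.
have cvg_v : v @ \oo --> (c%:R%:E : \bar R).
  apply: cvg_EFin; first exact: nearW.
  have : (fun P => (c%:R - (c + 2 * C)%:R * P.+1%:R^-1)%R : R) @ \oo -->
      ((c%:R - (c + 2 * C)%:R * 0)%R : R).
    by apply: cvgB; [exact: cvg_cst | apply: cvgMr; apply: cvg_harmonic].
  by rewrite mulr0 subr0.
rewrite -(cvg_limn_einf_sup cvg_v).1; apply: le_limn_einf => -[|P].
  rewrite lee_fin invr0 mul0r invr1 mulr1 natrD opprD addrA subrr add0r.
  by rewrite oppr_le0 ler0n.
rewrite lee_fin; have := ge_c P.+1; set X := (\sum_(1 <= p < _) _)%N.
rewrite -(ler_nat R) natrM natrD; set p : R := P.+1%:R => le_X.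
have p_ge1 : (1 <= p)%R by rewrite ler1n.
have -> : (P.+2%:R = p + 1)%R by rewrite -natr1.
rewrite natrD natrM.
have c_ge0 : (0 <= c%:R :> R)%R by rewrite ler0n.
have C_ge0 : (0 <= C%:R :> R)%R by rewrite ler0n.
have p_gt0 : (0 < p)%R by lra.
apply: (@le_trans _ _ (c%:R - C%:R / p)%R).
  rewrite lerB // ler_pdivrMr // mulrAC ler_pdivlMr; last by lra.
  by nra.
by rewrite ler_pdivlMl // mulrBr mulrCA divff ?gt_eqF // mulr1; lra.
Qed.

End AverageLatency.

Theorem proposition6p3 (R : realType) (N : parallel_network) (K : nat)
    (K_gt0 : (0 < K)%N) (delta : K.-tuple nat)
    (delta_inflow : delta \in inflow_vector K (capacity N)) :
  is_opt N delta
    ((K * \sum_(e : edge N) cap e * transit e)%N%:R%:E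
       + uniform_distance R (capacity N) delta)%E /\
  weq N delta R =
    ((K * capacity N * \max_(e : edge N) transit e)%N%:R%:E
       + uniform_distance R (capacity N) delta)%E.
Proof.
rewrite (uniform_distance_virtual K_gt0 delta_inflow) -!EFinD -!natrD.
have [z Kz Bz] := virtual_zero K_gt0 delta_inflow.
set opt := (_ + _)%N.
have ge_opt (sigma : profile N delta) :
    (opt%:R%:E <= limn_einf (avg_latency R sigma))%E.
  have [C lower] := period_latency_lower K_gt0 delta_inflow sigma Kz Bz.
  apply: (@limn_einf_avg_latency _ _ _ _ _ _ C) => P.
  apply: leq_trans (lower P); rewrite leq_mul2l leq_add2r leq_mul2l.
  by rewrite leq_addl !orbT.
split.
  have [sigma0 sigma0E] := exists_optimal_profile K_gt0 delta_inflow.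
  have sigma0_le : (limn_esup (avg_latency R sigma0) <= opt%:R%:E)%E.
    by apply: limn_esup_avg_latency => p p_gt0; rewrite sigma0E.
  split=> [|sigma sigma_opt].
    by exists sigma0 => sigma; apply: le_trans sigma0_le (ge_opt sigma).
  (* Comparison with [sigma0] bounds the upper limit by [opt], and [ge_opt] bounds the lower one. *)
  apply: limn_einf_esup_cvg => //; apply: le_trans (sigma_opt sigma0) _.
  exact: le_trans (limn_einf_sup _) sigma0_le.
have [sigma nash [C lower]] := exists_greedy_profile K_gt0 delta_inflow.
apply/le_anti/andP; split.
  apply: ge_ereal_sup => _ [sigma' /ufr_nash nash' <-].
  by apply: limn_esup_avg_latency => p; apply: nash_period_upper.
apply: (@le_trans _ _ (limn_esup (avg_latency R sigma))).
  exact: le_trans (limn_einf_avg_latency R lower) (limn_einf_sup _).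
by apply: ereal_sup_ubound; exists sigma => //; apply/ufr_nash.
Qed.
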